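(* Let $R$ be a finite non-commutative ring and let $r\in R$. If $p$ is the smallest prime dividing $|R|$ and $r\neq 0$, then $$\mathrm{Pr}_r(R) \leq \frac{|R|-|Z(R)|}{p|R|} < \frac{1}{p}.$$
   Context: For a ring $R$ and $x,y\in R$, the commutator is $[x,y] := xy-yx$. For a finite ring $R$ and $r\in R$, $\mathrm{Pr}_r(R) := \frac{|\{(x,y)\in R\times R : [x,y]=r\}|}{|R\times R|}$. $Z(R) := \{z \in R : zy = yz \text{ for all } y\in R\}$ is the center of $R$. *)

(* Defs.v *)
From mathcomp Require Import all_boot all_order all_algebra.

Set Implicit Arguments.
Unset Strict Implicit.
Unset Printing Implicit Defensive.

Import GRing.Theory.
Local Open Scope ring_scope.

(* Rings are associative but need not have an identity element.  MathComp's
   ring structures are all unital, so a ring is taken here to be a [zmodType]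
   together with a multiplication satisfying the ring axioms. *)
Record is_ring_mul (R : zmodType) (mul : R -> R -> R) : Prop := IsRingMul {
  ring_mulA : associative mul;
  ring_mulDl : left_distributive mul +%R;
  ring_mulDr : right_distributive mul +%R
}.

Lemma unital_is_ring_mul (R : pzRingType) : @is_ring_mul R *%R.
Proof. by split; [exact: mulrA | exact: mulrDl | exact: mulrDr]. Qed.

Definition commutator (R : zmodType) (mul : R -> R -> R) (x y : R) : R :=
  mul x y - mul y x.

Definition center (R : finZmodType) (mul : R -> R -> R) : {set R} :=
  [set z : R | [forall y : R, mul z y == mul y z]].

Definition Pr (R : finZmodType) (mul : R -> R -> R) (r : R) : rat :=
  #|[set xy : R * R | commutator mul xy.1 xy.2 == r]|%:R
    / #|[set: R * R]|%:R.

(* Main.v *)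
(* For a non-central x, the map y |-> [x, y] is additive and nonzero, so each of
   its fibres is empty or a coset of its kernel, a proper subgroup of (R, +),
   whose index is at least p.  A central x contributes no pair since r <> 0. *)
From HB Require Import structures.
From mathcomp Require Import all_fingroup.
Require Import Defs.
From mathcomp Require Import all_boot all_order all_algebra.
Import GRing.Theory Num.Theory.

Set Implicit Arguments.
Unset Strict Implicit.
Unset Printing Implicit Defensive.

Local Open Scope ring_scope.

(** By Lagrange it suffices that the index is at least [p]. The index exceeds 1 and divides [#|G|],
    so its least prime factor is a prime divisor of [#|G|]. *)
Lemma card_proper_subgroup (gT : finGroupType) (G H : {group gT}) (p : nat) :
  (forall q : nat, prime q -> (q %| #|G|)%N -> (p <= q)%N) ->
  H \proper G -> (p * #|H| <= #|G|)%N.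
Proof.
move=> p_min /andP[sHG nsGH].
have idx_gt1 : (1 < #|G : H|%g)%N by rewrite indexg_gt1.
rewrite -(Lagrange sHG) mulnC leq_mul2l; apply/orP; right.
apply: leq_trans (pdiv_leq (ltnW idx_gt1)).
apply: p_min (pdiv_prime idx_gt1) _.
exact: dvdn_trans (pdiv_dvd _) (dvdn_indexg _ _).
Qed.

Lemma card_fiber_additive (U V : finZmodType) (f : {additive U -> V})
    (v : V) (p : nat) :
  (forall q : nat, prime q -> (q %| #|U|)%N -> (p <= q)%N) ->
  (exists u : U, f u != 0) ->
  (p * #|[set u | f u == v]| <= #|U|)%N.
Proof.
move=> p_min [u fu_neq0].
have kerG : group_set [set w | f w == 0].
  apply/group_setP; split=> [|a b]; rewrite !inE ?raddf0 //.
  by move=> /eqP fa /eqP fb; rewrite FinRing.zmodMgE raddfD fa fb addr0.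
have ker_proper : group kerG \proper [set: U]%G.
  by rewrite properT; apply/eqP => /setP/(_ u); rewrite !inE (negPf fu_neq0).
have := card_proper_subgroup (G := [set: U]%G) (p := p) _ ker_proper.
rewrite cardsT => /(_ p_min); apply: leq_trans; rewrite leq_mul2l.
apply/orP; right.
have [-> | [u0]] := set_0Vmem [set w | f w == v]; first by rewrite cards0.
rewrite inE => /eqP fu0.
(* Translation by [- u0], where [u0] lies in the fibre, is injective and sends the fibre into the
   kernel. *)
rewrite -(card_imset _ (addIr (- u0))) subset_leq_card //.
apply/subsetP => _ /imsetP[w + ->]; rewrite !inE raddfB => /eqP ->.
by rewrite fu0 subrr.
Qed.

Lemma commutator_is_additive (R : zmodType) (mul : R -> R -> R) (x : R) :
  is_ring_mul mul -> zmod_morphism (commutator mul x).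
Proof.
move=> [_ mulDl mulDr] a b; rewrite /commutator.
have mulBl s t u : mul (s - t) u = mul s u - mul t u.
  by apply/(addIr (mul t u)); rewrite -mulDl !subrK.
have mulBr s t u : mul u (s - t) = mul u s - mul u t.
  by apply/(addIr (mul u t)); rewrite -mulDr !subrK.
by rewrite mulBl mulBr !opprD addrACA.
Qed.

(** The boolean factor, read as 0 or 1, covers central and non-central [x] in one bound that can be
    summed over [x]. *)
Lemma card_commutator_fiber (R : finZmodType) (mul : R -> R -> R) (r x : R)
    (p : nat) :
  is_ring_mul mul ->
  (forall q : nat, prime q -> (q %| #|R|)%N -> (p <= q)%N) -> r != 0 ->
  (p * #|[set y | commutator mul x y == r]| <= (x \notin center mul) * #|R|)%N.
Proof.
move=> ringR p_min r_neq0; case: (boolP (x \in center mul)) => /=.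
  rewrite inE => /forallP xZ; rewrite mul0n leqn0 muln_eq0 cards_eq0.
  apply/orP; right; apply/eqP/setP => y; rewrite !inE /commutator.
  by rewrite (eqP (xZ y)) subrr eq_sym (negPf r_neq0).
rewrite inE negb_forall => /existsP[y xy_neq]; rewrite mul1n.
(* Additivity depends on the hypothesis [ringR], so the morphism structure is built locally. *)
pose f_add := GRing.isZmodMorphism.Build _ _ (commutator mul x)
  (commutator_is_additive x ringR).
pose f : {additive R -> R} := HB.pack (commutator mul x) f_add.
apply: (@card_fiber_additive _ _ f) => //.
by exists y; rewrite /= /commutator subr_eq0.
Qed.

Lemma card_commutator_pairs (R : finZmodType) (mul : R -> R -> R) (r : R)
    (p : nat) :
  is_ring_mul mul ->
  (forall q : nat, prime q -> (q %| #|R|)%N -> (p <= q)%N) -> r != 0 ->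
  (p * #|[set xy : R * R | commutator mul xy.1 xy.2 == r]|
    <= (#|R| - #|center mul|) * #|R|)%N.
Proof.
move=> ringR p_min r_neq0.
have -> : #|[set xy : R * R | commutator mul xy.1 xy.2 == r]|
    = (\sum_x #|[set y | commutator mul x y == r]|)%N.
  (* The pairs are counted by their first coordinate. *)
  under eq_bigr do rewrite -sum1dep_card.
  by rewrite -sum1dep_card pair_big_dep.
have -> : (#|R| - #|center mul| = \sum_x (x \notin center mul))%N.
  (* The difference is the size of the complement of the center, written as a sum of indicators. *)
  rewrite -[center mul]setCK -cardsCs setCK -sum1_card big_mkcond.
  by apply: eq_bigr => x _; rewrite inE; case: (_ \in _).
rewrite big_distrr big_distrl; apply: leq_sum => x _.
exact: card_commutator_fiber.
Qed.

Theorem proposition2p10 (R : finZmodType) (mul : R -> R -> R)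
    (ringR : is_ring_mul mul) (noncommR : ~ commutative mul)
    (r : R) (p : nat)
    (p_prime : prime p) (p_dvd : (p %| #|R|)%N)
    (p_min : forall q : nat, prime q -> (q %| #|R|)%N -> (p <= q)%N)
    (r_neq0 : r <> 0) :
  Pr mul r <= (#|R|%:R - #|center mul|%:R) / (p%:R * #|R|%:R) :> rat
  /\ (#|R|%:R - #|center mul|%:R) / (p%:R * #|R|%:R) < 1 / p%:R :> rat.
Proof.
have R_gt0 : (0 : rat) < #|R|%:R by rewrite ltr0n; apply/card_gt0P; exists 0.
have p_gt0 : (0 : rat) < p%:R by rewrite ltr0n prime_gt0.
(* The strict inequality rests on this: 0 is central, since distributivity and cancellation make
   both of its products with [y] vanish. *)
have Z_gt0 : (0 : rat) < #|center mul|%:R.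
  rewrite ltr0n; apply/card_gt0P; exists 0; rewrite inE; apply/forallP => y.
  have [_ mulDl mulDr] := ringR; apply/eqP; transitivity (0 : R).
    by apply: (addIr (mul 0 y)); rewrite -mulDl !add0r.
  by apply/esym/(addIr (mul y 0)); rewrite -mulDr !add0r.
split.
  have/eqP r_neq0b := r_neq0.
  have := card_commutator_pairs ringR p_min r_neq0b.
  (* The truncated subtraction on [nat] becomes a true one in [rat] because the center has at most
     [#|R|] elements. *)
  rewrite -(ler_nat rat) !natrM natrB ?max_card // => le_pairs.
  rewrite /Pr cardsT card_prod natrM ler_pdivrMr ?mulr_gt0 //.
  rewrite mulrAC ler_pdivlMr ?mulr_gt0 //.
  by rewrite mulrCA !mulrA ler_pM2r // mulrC.
rewrite ltr_pdivrMr ?mulr_gt0 // mulrA divfK ?lt0r_neq0 //.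
by rewrite mul1r ltrBlDr ltrDl.
Qed.
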